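(* Let $\mathfrak C$ be a class of groups that satisfies one of the following two conditions: (1) it contains groups $G$ and $H$ (possibly equal) and a nontrivial homomorphism $f:G\to Z(H)$; (2) it contains a group that is decomposable as a direct product of nontrivial groups. Then $\mathfrak C$ does not recognize coordinates.
   Context: $Z(H)$ denotes the center of $H$. Reduced product: for an ideal $\mathcal I$ on $\mathbb I$ (closed under subsets and finite unions, $\mathbb I\notin\mathcal I$), $\prod_{\mathcal I}G_i$ is $\prod_iG_i$ modulo $(a_i)\simeq(b_i)\iff\{i\mid a_i\ne b_i\}\in\mathcal I$; for $S\in\mathcal P(\mathbb I)/\mathcal I$, $\mathcal M\restriction S$ is the quotient onto a representative of $S$ with quotient map $\pi_S$. An isomorphism $\Phi:\prod_{\mathcal I}G_i\to\prod_{\mathcal J}H_j$ is isomorphically coordinate respecting if there is an isomorphism $\alpha:\mathcal P(\mathbb I)/\mathcal I\to\mathcal P(\mathbb J)/\mathcal J$ such that for all $S$ the map $\pi_S(a)\mapsto\pi_{\alpha(S)}(\Phi(a))$ is well defined. A class recognizes coordinates if every isomorphism between reduced products (any index sets and ideals, including the trivial ideal $\{\emptyset\}$, repetitions allowed) of its members is isomorphically coordinate respecting. *)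

(* Defs.v *)
From HB Require Import structures.
From mathcomp Require Import all_boot all_order.
From mathcomp Require Import generic_quotient.
From mathcomp Require Import boolp classical_sets.

Set Implicit Arguments.
Unset Strict Implicit.
Unset Printing Implicit Defensive.

Import Order.TTheory.

Local Open Scope classical_set_scope.
Local Open Scope group_scope.
Local Open Scope quotient_scope.

(* Properness is a separate predicate because the restriction of a proper     *)
(* ideal to one of its own members is not proper.                             *)
Record ideal_on (I : Type) := IdealOn {
  ideal_sets :> set I -> Prop;
  ideal0 : ideal_sets set0;
  idealS : forall A B : set I, A `<=` B -> ideal_sets B -> ideal_sets A;
  idealU : forall A B : set I,
    ideal_sets A -> ideal_sets B -> ideal_sets (A `|` B) }.

Definition proper_ideal (I : Type) (J : ideal_on I) : Prop := ~ J setT.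

Section RestrictedIdeal.
Variables (I : Type) (J : ideal_on I) (S : set I).

Definition restr_sets : set (set S) :=
  [set A | J [set \val i | i in A]].

Fact restr_sets0 : restr_sets set0.
Proof. by rewrite /restr_sets/= image_set0; exact: ideal0. Qed.

Fact restr_setsS (A B : set S) : A `<=` B -> restr_sets B -> restr_sets A.
Proof. by move=> AB; apply: idealS; exact: image_subset. Qed.

Fact restr_setsU (A B : set S) :
  restr_sets A -> restr_sets B -> restr_sets (A `|` B).
Proof. by rewrite /restr_sets/= image_setU; exact: idealU. Qed.

Definition restr_ideal : ideal_on S :=
  IdealOn restr_sets0 restr_setsS restr_setsU.

End RestrictedIdeal.

Section QuotientAlgebra.
Variables (I : Type) (J : ideal_on I).
Implicit Types A B C : set I.

Definition set_eqmod A B : bool := `[< J ((A `\` B) `|` (B `\` A)) >].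

Fact set_eqmod_refl : reflexive set_eqmod.
Proof. by move=> A; apply/asboolP; rewrite setDv setU0; exact: ideal0. Qed.

Fact set_eqmod_sym : symmetric set_eqmod.
Proof. by move=> A B; rewrite /set_eqmod setUC. Qed.

Fact set_eqmod_trans : transitive set_eqmod.
Proof.
move=> B A C /asboolP JAB /asboolP JBC; apply/asboolP.
apply: idealS (idealU JAB JBC) => i /=.
by have [] := pselect (B i); tauto.
Qed.

Canonical set_eqmod_equiv :=
  EquivRel set_eqmod set_eqmod_refl set_eqmod_sym set_eqmod_trans.

Definition powset_quot : Type := {eq_quot set_eqmod}.
HB.instance Definition _ := Choice.on powset_quot.
HB.instance Definition _ := EqQuotient.on powset_quot.

Lemma powset_quotP A B :
  \pi_powset_quot A = \pi_powset_quot B <-> J ((A `\` B) `|` (B `\` A)).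
Proof. by split=> [/eqmodP/asboolP | JAB] //; apply/eqmodP/asboolP. Qed.

Definition pq_meet := lift_op2 powset_quot (@setI I).
Definition pq_join := lift_op2 powset_quot (@setU I).
Definition pq_diff := lift_op2 powset_quot (@setD I).
Definition pq_compl := lift_op1 powset_quot (@setC I).

Fact pi_pq_op2 (op : set I -> set I -> set I) :
    (forall A A' B B', op A B `\` op A' B' `<=`
       ((A `\` A') `|` (A' `\` A)) `|` ((B `\` B') `|` (B' `\` B))) ->
  {morph \pi_powset_quot : A B / op A B >-> lift_op2 powset_quot op A B}.
Proof.
move=> opP A B; unlock; apply/powset_quotP.
have JA : J ((A `\` repr (\pi_powset_quot A)) `|` (repr (\pi_powset_quot A) `\` A)).
  by apply/powset_quotP; rewrite reprK.
have JB : J ((B `\` repr (\pi_powset_quot B)) `|` (repr (\pi_powset_quot B) `\` B)).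
  by apply/powset_quotP; rewrite reprK.
apply: idealS (idealU JA JB); rewrite subUset; split; first exact: opP.
by rewrite [X in X `|` _]setUC [X in _ `|` X]setUC; exact: opP.
Qed.

Fact pi_pq_meet : {morph \pi_powset_quot : A B / A `&` B >-> pq_meet A B}.
Proof.
apply: pi_pq_op2 => A A' B B' i /=.
by have [] := pselect (B' i); have [] := pselect (A' i); tauto.
Qed.

Fact pi_pq_join : {morph \pi_powset_quot : A B / A `|` B >-> pq_join A B}.
Proof.
apply: pi_pq_op2 => A A' B B' i /=.
by have [] := pselect (B' i); have [] := pselect (A' i); tauto.
Qed.

Fact pi_pq_diff : {morph \pi_powset_quot : A B / A `\` B >-> pq_diff A B}.
Proof.
apply: pi_pq_op2 => A A' B B' i /=.
by have [] := pselect (B' i); have [] := pselect (A' i); tauto.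
Qed.

Fact pi_pq_compl : {morph \pi_powset_quot : A / ~` A >-> pq_compl A}.
Proof.
move=> A; unlock pq_compl; apply/powset_quotP.
have JA : J ((A `\` repr (\pi_powset_quot A)) `|` (repr (\pi_powset_quot A) `\` A)).
  by apply/powset_quotP; rewrite reprK.
apply: idealS JA => i /=.
by have [] := pselect (A i); have [] := pselect (repr (\pi_powset_quot A) i); tauto.
Qed.

Canonical pi_pq_meet_morph := PiMorph2 pi_pq_meet.
Canonical pi_pq_join_morph := PiMorph2 pi_pq_join.
Canonical pi_pq_diff_morph := PiMorph2 pi_pq_diff.
Canonical pi_pq_compl_morph := PiMorph1 pi_pq_compl.

Fact pq_meetC : commutative pq_meet.
Proof. by elim/quotW=> A; elim/quotW=> B; rewrite !piE setIC. Qed.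

Fact pq_joinC : commutative pq_join.
Proof. by elim/quotW=> A; elim/quotW=> B; rewrite !piE setUC. Qed.

Fact pq_meetA : associative pq_meet.
Proof.
by elim/quotW=> A; elim/quotW=> B; elim/quotW=> C; rewrite !piE setIA.
Qed.

Fact pq_joinA : associative pq_join.
Proof.
by elim/quotW=> A; elim/quotW=> B; elim/quotW=> C; rewrite !piE setUA.
Qed.

Fact pq_joinKI (B A : powset_quot) : pq_meet A (pq_join A B) = A.
Proof. by elim/quotW: A => A; elim/quotW: B => B; rewrite !piE setUC setKU. Qed.

Fact pq_meetKU (B A : powset_quot) : pq_join A (pq_meet A B) = A.
Proof. by elim/quotW: A => A; elim/quotW: B => B; rewrite !piE setIC setKI. Qed.

Fact pq_meetUl : left_distributive pq_meet pq_join.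
Proof.
by elim/quotW=> A; elim/quotW=> B; elim/quotW=> C; rewrite !piE setIUl.
Qed.

Fact pq_meetxx : idempotent_op pq_meet.
Proof. by elim/quotW=> A; rewrite !piE setIid. Qed.

HB.instance Definition _ :=
  @Order.isMeetJoinDistrLattice.Build set_display powset_quot
    (fun X Y => pq_meet X Y == X) (fun X Y => (Y != X) && (pq_meet X Y == X))
    pq_meet pq_join (fun _ _ => erefl) (fun _ _ => erefl)
    pq_meetC pq_joinC pq_meetA pq_joinA pq_joinKI pq_meetKU pq_meetUl
    pq_meetxx.

Fact pq_le0 (A : powset_quot) : (\pi_powset_quot set0 <= A)%O.
Proof. by apply/eqP; elim/quotW: A => A; rewrite !piE set0I. Qed.

Fact pq_leT (A : powset_quot) : (A <= \pi_powset_quot setT)%O.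
Proof. by apply/eqP; elim/quotW: A => A; rewrite !piE setIT. Qed.

HB.instance Definition _ :=
  Order.hasBottom.Build set_display powset_quot pq_le0.
HB.instance Definition _ :=
  Order.hasTop.Build set_display powset_quot pq_leT.

Fact pq_diffKI (A B : powset_quot) : (B `&` pq_diff A B)%O = \bot%O.
Proof.
elim/quotW: A => A; elim/quotW: B => B; rewrite /Order.meet/= !piE.
by rewrite setDE setICA setICr setI0.
Qed.

Fact pq_joinIB (A B : powset_quot) : ((A `&` B) `|` pq_diff A B)%O = A.
Proof.
elim/quotW: A => A; elim/quotW: B => B; rewrite /Order.meet/= /Order.join/= !piE.
by rewrite setUC -setDDr setDv setD0.
Qed.

HB.instance Definition _ :=
  Order.BDistrLattice_hasSectionalComplement.Build set_display powset_quot
    pq_diffKI pq_joinIB.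

Fact pq_complE (A : powset_quot) : pq_compl A = ((\top : powset_quot) `\` A)%O.
Proof. by elim/quotW: A => A; rewrite /Order.diff/= !piE setTD. Qed.

HB.instance Definition _ :=
  Order.CBDistrLattice_hasComplement.Build set_display powset_quot pq_complE.

End QuotientAlgebra.

Definition bool_alg_iso (d d' : Order.disp_t)
    (B : ctbDistrLatticeType d) (B' : ctbDistrLatticeType d') (f : B -> B') :=
  [/\ bijective f,
      {morph f : x y / (x `&` y)%O >-> (x `&` y)%O},
      {morph f : x y / (x `|` y)%O >-> (x `|` y)%O}
    & {morph f : x / (~` x)%O >-> (~` x)%O}].

Section ReducedProduct.
Variables (I : Type) (J : ideal_on I) (G : I -> groupType).
Implicit Types a b c : forall i, G i.

Definition prod_eqmod a b : bool := `[< J [set i | a i <> b i] >].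

Fact prod_eqmod_refl : reflexive prod_eqmod.
Proof. by move=> a; apply/asboolP; apply: idealS (ideal0 J) => i /=. Qed.

Fact prod_eqmod_sym : symmetric prod_eqmod.
Proof.
by move=> a b; apply/asboolP/asboolP; apply: idealS => i /= + ab; apply.
Qed.

Fact prod_eqmod_trans : transitive prod_eqmod.
Proof.
move=> b a c /asboolP Jab /asboolP Jbc; apply/asboolP.
apply: idealS (idealU Jab Jbc) => i /= ac.
by have [ab|] := pselect (a i = b i); [right; rewrite -ab|left].
Qed.

Canonical prod_eqmod_equiv :=
  EquivRel prod_eqmod prod_eqmod_refl prod_eqmod_sym prod_eqmod_trans.

Definition redprod : Type := {eq_quot prod_eqmod}.
HB.instance Definition _ := Choice.on redprod.
HB.instance Definition _ := EqQuotient.on redprod.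

Lemma redprodP a b :
  \pi_redprod a = \pi_redprod b <-> J [set i | a i <> b i].
Proof. by split=> [/eqmodP/asboolP | Jab] //; apply/eqmodP/asboolP. Qed.

Lemma redprod_repr a : J [set i | a i <> repr (\pi_redprod a) i].
Proof. by apply/redprodP; rewrite reprK. Qed.

Definition prod_mul a b : forall i, G i := fun i => a i * b i.
Definition prod_inv a : forall i, G i := fun i => (a i)^-1.
Definition prod_one : forall i, G i := fun i => 1.

Definition redprod_mul := lift_op2 redprod prod_mul.
Definition redprod_inv := lift_op1 redprod prod_inv.
Definition redprod_one := lift_cst redprod prod_one.

Fact pi_redprod_mul :
  {morph \pi_redprod : a b / prod_mul a b >-> redprod_mul a b}.
Proof.
move=> a b; unlock redprod_mul; apply/redprodP.
apply: idealS (idealU (redprod_repr a) (redprod_repr b)) => i /=.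
rewrite /prod_mul => ab.
by apply: contrapT => /not_orP[/contrapT aE /contrapT bE]; rewrite -aE -bE in ab.
Qed.

Fact pi_redprod_inv :
  {morph \pi_redprod : a / prod_inv a >-> redprod_inv a}.
Proof.
move=> a; unlock redprod_inv; apply/redprodP.
apply: idealS (redprod_repr a) => i /=.
by rewrite /prod_inv => + aE; apply; rewrite -aE.
Qed.

Canonical pi_redprod_one_morph := PiConst redprod_one.
Canonical pi_redprod_mul_morph := PiMorph2 pi_redprod_mul.
Canonical pi_redprod_inv_morph := PiMorph1 pi_redprod_inv.

Fact redprod_mulA : associative redprod_mul.
Proof.
elim/quotW=> a; elim/quotW=> b; elim/quotW=> c; rewrite !piE.
by congr \pi; apply: functional_extensionality_dep => i; exact: mulgA.
Qed.

Fact redprod_mul1 : left_id redprod_one redprod_mul.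
Proof.
elim/quotW=> a; rewrite !piE.
by congr \pi; apply: functional_extensionality_dep => i; exact: mul1g.
Qed.

Fact redprod_1mul : right_id redprod_one redprod_mul.
Proof.
elim/quotW=> a; rewrite !piE.
by congr \pi; apply: functional_extensionality_dep => i; exact: mulg1.
Qed.

Fact redprod_mulV : left_inverse redprod_one redprod_inv redprod_mul.
Proof.
elim/quotW=> a; rewrite !piE.
by congr \pi; apply: functional_extensionality_dep => i; exact: mulVg.
Qed.

Fact redprod_Vmul : right_inverse redprod_one redprod_inv redprod_mul.
Proof.
elim/quotW=> a; rewrite !piE.
by congr \pi; apply: functional_extensionality_dep => i; exact: mulgV.
Qed.

HB.instance Definition _ := isGroup.Build redprod
  redprod_mulA redprod_mul1 redprod_1mul redprod_mulV redprod_Vmul.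

End ReducedProduct.

Section Restriction.
Variables (I : Type) (J : ideal_on I) (G : I -> groupType).

Definition prod_restr (S : set I) (a : forall i, G i) :
  forall i : S, G (\val i) := fun i => a (\val i).
Arguments prod_restr S a i : clear implicits.

Definition redprod_restr (S : powset_quot J) : groupType :=
  redprod (restr_ideal J (repr S)) (fun i : repr S => G (\val i)).

Definition restr_proj (S : powset_quot J) (a : redprod J G) : redprod_restr S :=
  \pi_(redprod _ _) (prod_restr (repr S) (repr a)).

Arguments restr_proj S a : clear implicits.

Lemma restr_projE (S : powset_quot J) (a : forall i, G i) :
  restr_proj S (\pi_(redprod J G) a) =
  \pi_(redprod _ _) (prod_restr (repr S) a).
Proof.
apply/redprodP; apply: idealS (redprod_repr J a).
by move=> _ [i /= ai <-] /esym.
Qed.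

Lemma restr_projM (S : powset_quot J) :
  {morph @restr_proj S : a b / a * b >-> a * b}.
Proof.
elim/quotW=> a; elim/quotW=> b.
by rewrite /mul/= -pi_redprod_mul !restr_projE -pi_redprod_mul.
Qed.

End Restriction.

(* The existence of PhiS says that the assignment                             *)
(* restr_proj S a |-> restr_proj (alpha S) (Phi a) is well defined.           *)
Definition isom_coord_respecting (I K : Type) (J : ideal_on I) (L : ideal_on K)
    (G : I -> groupType) (H : K -> groupType)
    (Phi : redprod J G -> redprod L H) : Prop :=
  exists2 alpha : powset_quot J -> powset_quot L, bool_alg_iso alpha &
    forall S : powset_quot J,
      exists PhiS : redprod_restr G S -> redprod_restr H (alpha S),
        forall a : redprod J G,
          PhiS (restr_proj S a) = restr_proj (alpha S) (Phi a).

Definition recognizes_coordinates (C : groupType -> Prop) : Prop :=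
  forall (I K : Type) (J : ideal_on I) (L : ideal_on K)
         (G : I -> groupType) (H : K -> groupType),
    proper_ideal J -> proper_ideal L ->
    (forall i, C (G i)) -> (forall k, C (H k)) ->
  forall Phi : {multiplicative redprod J G -> redprod L H},
    bijective Phi -> isom_coord_respecting Phi.

Definition center (G : groupType) : set G := [set z | forall g, commute z g].
Arguments center G : clear implicits.

Definition nontrivial (G : groupType) : Prop := exists g : G, g <> 1.

Definition decomposable (G : groupType) : Prop :=
  exists A B : groupType, [/\ nontrivial A, nontrivial B &
    exists f : {multiplicative G -> (A * B)%type}, bijective f].

(* Main.v *)
(* For the trivial ideal, reduced products are plain products. Suppose that F
   is an automorphism of a product whose k-th output depends on every input
   coordinate separately, and that alpha S = {k}. If j is not in S, two elements
   that differ only at j agree on S and can be chosen with images differing at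
   k; hence S is the whole index set, and so is alpha S, a contradiction. For a
   central homomorphism f : G -> H take (g, h) |-> (g, f g * h) with k the
   coordinate of H; for G = A x B exchange the B-factors of two copies of G. *)
Require Import Defs.
From HB Require Import structures.
From mathcomp Require Import all_boot all_order generic_quotient.
From mathcomp Require Import boolp classical_sets.

Set Implicit Arguments.
Unset Strict Implicit.
Unset Printing Implicit Defensive.

Import Order.Theory.

Local Open Scope classical_set_scope.
Local Open Scope group_scope.
Local Open Scope quotient_scope.

Lemma mulmorph1 (G H : groupType) (f : {multiplicative G -> H}) : f 1 = 1.
Proof. by apply: (mulgI (f 1)); rewrite -gmulfM !mulg1. Qed.

Section TrivialIdeal.
Variable I : Type.

Fact trivial_idealS (A B : set I) : A `<=` B -> B = set0 -> A = set0.
Proof. by move=> AB B0; apply/seteqP; split=> //; rewrite -B0. Qed.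

Fact trivial_idealU (A B : set I) : A = set0 -> B = set0 -> A `|` B = set0.
Proof. by move=> -> ->; rewrite setU0. Qed.

Definition trivial_ideal : ideal_on I :=
  @IdealOn I (fun A => A = set0) erefl trivial_idealS trivial_idealU.

Lemma trivial_ideal_proper : I -> proper_ideal trivial_ideal.
Proof. by move=> i /seteqP[/(_ i) /= + _]; apply. Qed.

(** Equivalent sets have empty symmetric difference here, so every class is a singleton and [repr]
    recovers the set itself. *)
Lemma trivial_powset_repr (A : set I) :
  repr (\pi_(powset_quot trivial_ideal) A) = A.
Proof.
have /seteqP[ARA _] : trivial_ideal
    ((A `\` repr (\pi_(powset_quot trivial_ideal) A))
     `|` (repr (\pi_(powset_quot trivial_ideal) A) `\` A)).
  by apply/powset_quotP; rewrite reprK.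
apply/seteqP; split=> i Ai; apply: contrapT => nAi; apply: (ARA i).
- by right.
- by left.
Qed.

Variable G : I -> groupType.

Lemma trivial_redprod_repr (a : forall i, G i) :
  repr (\pi_(redprod trivial_ideal G) a) = a.
Proof.
have /seteqP[aE _] := redprod_repr trivial_ideal a.
apply: functional_extensionality_dep => i.
by apply: contrapT => ai; apply: (aE i) => /esym.
Qed.

Lemma restr_proj_trivialP (S : powset_quot trivial_ideal)
    (a b : forall i, G i) :
  restr_proj S (\pi_(redprod trivial_ideal G) a)
    = restr_proj S (\pi_(redprod trivial_ideal G) b)
  <-> forall i, repr S i -> a i = b i.
Proof.
rewrite !restr_projE; split=> [/redprodP/= /seteqP[abE _] i Si|ab].
  apply: contrapT => nab; apply: (abE i).
  by exists (exist _ i (mem_set Si)).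
apply/redprodP => /=; apply/seteqP; split=> // _ [[i Si] /= + _].
by rewrite /prod_restr /=; apply; apply: ab; exact: set_mem.
Qed.

Variable F : (forall i, G i) -> forall i, G i.
Hypothesis FM : forall a b i, F (prod_mul a b) i = F a i * F b i.

Definition redprod_lift (x : redprod trivial_ideal G) :
  redprod trivial_ideal G := \pi_(redprod trivial_ideal G) (F (repr x)).

Lemma redprod_liftE a : redprod_lift (\pi_(redprod trivial_ideal G) a) =
  \pi_(redprod trivial_ideal G) (F a).
Proof. by rewrite /redprod_lift trivial_redprod_repr. Qed.

Lemma redprod_liftM : {morph redprod_lift : x y / x * y}.
Proof.
elim/quotW=> a; elim/quotW=> b; rewrite /mul/= -pi_redprod_mul !redprod_liftE.
rewrite -pi_redprod_mul; congr \pi.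
by apply: functional_extensionality_dep => i; exact: FM.
Qed.

End TrivialIdeal.

(** The top is the join of any element with its complement, and [f] preserves both operations. *)
Lemma bool_alg_isoT (d d' : Order.disp_t) (B : ctbDistrLatticeType d)
    (B' : ctbDistrLatticeType d') (f : B -> B') :
  bool_alg_iso f -> f \top%O = \top%O.
Proof.
case=> _ _ fU fC.
by rewrite -(joinxC (\top%O : B)) fU fC joinxC.
Qed.

Section Mixing.
Variables (C : groupType -> Prop) (I : Type) (G : I -> groupType).
Variables (F F' : (forall i, G i) -> forall i, G i) (k l : I).
Hypothesis CG : forall i, C (G i).
Hypothesis FM : forall a b i, F (prod_mul a b) i = F a i * F b i.
Hypotheses (FK : cancel F F') (F'K : cancel F' F) (lk : l <> k).
Hypothesis mixF : forall j, exists2 a : forall i, G i,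
  (forall i, i <> j -> a i = 1) & F a k <> 1.

(** The inverse [F'] makes the lift of [F] bijective, [l] keeps [[set k]] from being the whole index
    set, and [mixF] says that every single coordinate can influence output [k]. *)
Lemma mixing_not_recognizes : ~ recognizes_coordinates C.
Proof.
move=> recC.
pose Phi : {multiplicative _ -> _} := HB.pack (redprod_lift F)
  (isMultiplicative.Build _ _ (redprod_lift F) (redprod_liftM FM)).
have PhiE a : Phi (\pi_(redprod _ G) a) = \pi_(redprod _ G) (F a).
  exact: redprod_liftE.
have Phi_bij : bijective Phi.
  exists (redprod_lift F') => x;
    by rewrite /Phi /= /redprod_lift trivial_redprod_repr (FK, F'K) reprK.
have Jp := trivial_ideal_proper k.
have [alpha alpha_iso well_def] := recC _ _ _ _ _ _ Jp Jp CG CG Phi Phi_bij.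
have [[beta _ betaK] _ _ _] := alpha_iso.
pose K := \pi_(powset_quot (trivial_ideal I)) [set k].
set S := beta K.
have alphaS : alpha S = K by exact: betaK.
(* If [S] contained every index it would be the top element, so its image [K] would be too, and [l]
   would lie in [[set k]]. *)
have [j nSj] : exists j, ~ repr S j.
  apply: contrapT => /forallNP allS; apply: lk.
  have ST : S = \top%O.
    rewrite -[S]reprK; congr \pi; apply/seteqP; split=> // i _.
    exact: contrapT (allS i).
  have KT : K = \top%O by rewrite -alphaS ST (bool_alg_isoT alpha_iso).
  have /seteqP[_ /(_ l)] : [set k] = [set: I].
    by rewrite -[LHS]trivial_powset_repr -[RHS]trivial_powset_repr -/K KT.
  exact.
(* The identity tuple is the second of the two elements to compare; its image at [k] is idempotent,
   hence trivial. *)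
have F1 : F (prod_one G) k = 1.
  apply: (mulgI (F (prod_one G) k)); rewrite mulg1 -FM.
  by congr (F _ k); apply: functional_extensionality_dep => i; exact: mulg1.
(* Since [j] is outside [S], [a] agrees with the identity on [S]; the map [PhiS] then forces their
   images to agree at [k]. *)
have [a a1] := mixF j; apply; rewrite -F1.
have [PhiS PhiSE] := well_def S.
have /restr_proj_trivialP : restr_proj (alpha S) (\pi_(redprod _ G) (F a))
    = restr_proj (alpha S) (\pi_(redprod _ G) (F (prod_one G))).
  rewrite -!PhiE -!PhiSE; congr PhiS; apply/restr_proj_trivialP => i Si.
  by apply: a1 => ij; apply: nSj; rewrite -ij.
by apply; rewrite alphaS trivial_powset_repr.
Qed.

End Mixing.

Lemma central_not_recognizes (C : groupType -> Prop) (G H : groupType)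
    (f : {multiplicative G -> H}) (x : G) :
  C G -> C H -> (forall y, center H (f y)) -> f x <> 1 ->
  ~ recognizes_coordinates C.
Proof.
move=> CG CH fZ fx1.
pose GH (b : bool) : groupType := if b then H else G.
pose pr (g : G) (h : H) : forall b, GH b :=
  fun b => if b as b return GH b then h else g.
pose F (a : forall b, GH b) := pr (a false) (f (a false) * a true).
pose F' (a : forall b, GH b) := pr (a false) ((f (a false))^-1 * a true).
apply: (@mixing_not_recognizes C bool GH F F' true false) => //.
- by case.
- move=> a b [] //=; rewrite /F /prod_mul /= gmulfM -!mulgA; congr (_ * _).
  (* Centrality lets [f (b false)] move past [a true]. *)
  by rewrite !mulgA; congr (_ * _); exact: fZ.
- by move=> a; apply: functional_extensionality_dep => -[]; rewrite /F' //= mulKg.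
- by move=> a; apply: functional_extensionality_dep => -[]; rewrite /F //= mulVKg.
(* Output [true] is [f (a false) * a true]: it becomes [f x] either by putting [f x] in the
   [H]-coordinate or by putting [x] in the [G]-coordinate. *)
- case.
    by exists (pr 1 (f x)) => [[]|] //; rewrite /F /= mulmorph1 mul1g.
  by exists (pr x 1) => [[]|] //; rewrite /F /= mulg1.
Qed.

Lemma decomposable_not_recognizes (C : groupType -> Prop) (G : groupType) :
  C G -> decomposable G -> ~ recognizes_coordinates C.
Proof.
move=> CG [A [B [[a a1] [b b1] [f [g fK gK]]]]].
have gM : {morph g : x y / x * y} := can2_gmulfM fK gK.
have g_eq1 x : g x = 1 -> x = 1.
  by move=> gx1; rewrite -(gK x) gx1 mulmorph1.
pose F (u : bool -> G) (i : bool) := g ((f (u i)).1, (f (u (~~ i))).2).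
(* Exchanging the [B]-components twice restores the pair, so [F] also serves as its own inverse. *)
have FK : cancel F F.
  move=> u; apply: functional_extensionality_dep => i.
  by rewrite /F !gK /= negbK -surjective_pairing fK.
pose single (j : bool) (x : A * B) (i : bool) : G := if i == j then g x else 1.
apply: (@mixing_not_recognizes C bool (fun=> G) F F true false) => //.
- by move=> u v i; rewrite /F -gM /prod_mul !gmulfM.
(* Output [true] takes its [A]-component from copy [true] and its [B]-component from copy [false],
   which dictates the nontrivial entry in each case. *)
- case; [exists (single true (a, 1))|exists (single false (1, b))].
  + by case.
  + by rewrite /F /single /= gK mulmorph1 => /g_eq1[].
  + by case.
  + by rewrite /F /single /= gK mulmorph1 => /g_eq1[].
Qed.

Theorem theorem5p1 (C : groupType -> Prop) :
  ((exists G H : groupType,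
      [/\ C G, C H &
          exists f : {multiplicative G -> H},
            (forall x : G, center H (f x)) /\ (exists x : G, f x <> 1%g)]) \/
   (exists G : groupType, C G /\ decomposable G)) ->
  ~ recognizes_coordinates C.
Proof.
case=> [[G [H [CG CH [f [fZ [x fx1]]]]]]|[G [CG decG]]].
- exact: central_not_recognizes CG CH fZ fx1.
- exact: decomposable_not_recognizes CG decG.
Qed.
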